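(* Let $M$ be a von Neumann algebra with identity $\boldsymbol{1}$, let $\mathbb{G}=\mathbb{N}_0$ or $\mathbb{G}=\mathbb{R}_+=[0,\infty)$, and let $(\varPhi_g : g\in\mathbb{G})$ be a semigroup of linear normal positive unital maps on $M$. Let $\omega$ be a normal faithful state on $M$ such that $\omega\circ\varPhi_g=\omega$ for all $g\in\mathbb{G}$. Assume that $(\varPhi_g)$ is ergodic, i.e. $\{y\in M : \varPhi_g(y)=y \text{ for all } g\in\mathbb{G}\}=\mathbb{C}\boldsymbol{1}$. Let $\lambda\in\mathbb{C}$ with $|\lambda|=1$ be an eigenvalue of $(\varPhi_g)$, let $M_\lambda=\{y\in M : \varPhi_g(y)=\lambda^g y \text{ for all } g\in\mathbb{G}\}$ be the corresponding eigenspace, and let $x\in M_\lambda$, $x\neq 0$, be an eigenvector. Then (at least) one of the following possibilities holds: (i) $x=\alpha v$, where $\alpha\in\mathbb{C}$ and $v$ is a partial isometry in $M_\lambda$ such that $v^*v=e$ and $vv^*=e^{\perp}$ for some nonzero projection $e$ with $e\neq\boldsymbol{1}$; (ii) $x=\alpha_1v_1+\alpha_2v_2$, where $\alpha_1,\alpha_2$ are nonzero complex numbers with $\alpha_1\neq\alpha_2$, and $v_1,v_2$ are partial isometries in $M_\lambda$ such that for some nonzero projection $e$ with $e\neq\boldsymbol{1}$, $$v_1^*v_1=e,\quad v_1v_1^*=e^{\perp},\quad v_2^*v_2=e^{\perp},\quad v_2v_2^*=e;$$ (iii) $x=\alpha u$, where $\alpha\in\mathbb{C}$ and $u$ is a unitary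 operator in $M_\lambda$.
   Context: Semigroup means $\varPhi_{g+h}=\varPhi_g\circ\varPhi_h$ for all $g,h\in\mathbb{G}$; when $\mathbb{G}=\mathbb{N}_0$ the semigroup has the form $(\varPhi^n : n=0,1,2,\dots)$ for a single linear normal positive unital map $\varPhi$ on $M$. No continuity in $g$ is assumed when $\mathbb{G}=\mathbb{R}_+$. Positive means that positive elements are mapped to positive elements (complete positivity or the Schwarz inequality is not assumed); unital means $\varPhi_g(\boldsymbol{1})=\boldsymbol{1}$; normal means $\sigma$-weakly continuous. A complex number $\lambda$ of modulus one is an eigenvalue of the semigroup if there is a nonzero $x\in M$ with $\varPhi_g(x)=\lambda^g x$ for every $g\in\mathbb{G}$; the set of all $x\in M$ satisfying this is the eigenspace $M_\lambda$, and its nonzero elements are the eigenvectors. For $\mathbb{G}=\mathbb{R}_+$, $\lambda^g$ is understood as $e^{i\theta g}$, where $\theta\in\mathbb{R}$ is a fixed number with $\lambda=e^{i\theta}$ (the same $\theta$ being used throughout the definition of $M_\lambda$). The fixed-point space $M_1$ is $\{y\in M:\varPhi_g(y)=y\ \forall g\in\mathbb{G}\}$. For a projection $e$, $e^{\perp}=\boldsymbol{1}-e$. *)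

(* Defs.v *)
From HB Require Import structures.
From mathcomp Require Import all_boot all_order all_algebra.
From mathcomp Require Import complex.
From mathcomp Require Import all_classical all_reals all_analysis.

Set Implicit Arguments.
Unset Strict Implicit.
Unset Printing Implicit Defensive.

Import Order.TTheory GRing.Theory Num.Theory.
Import numFieldNormedType.Exports.

Local Open Scope classical_set_scope.
Local Open Scope ring_scope.

(** * Complex Hilbert spaces

    The inner product is linear in its first argument. *)

HB.mixin Record isHilbert (R : realType) H of CompleteNormedModule R[i] H := {
  inner : {dot H for (Num.conj : R[i] -> R[i])};
  inner_normE : forall x : H, `|x| ^+ 2 = inner x x
}.

#[short(type="hilbertType")]
HB.structure Definition Hilbert (R : realType) :=
  {H of CompleteNormedModule R[i] H & isHilbert R H}.

(** * The algebra B(H) of bounded operators *)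

Section BoundedOperators.
Variables (R : realType) (H : hilbertType R).

Record bounded_op := BoundedOp {
  bop_fun :> H -> H;
  bop_linear : linear bop_fun;
  bop_continuous : continuous bop_fun
}.

Arguments bop_linear : clear implicits.
Arguments bop_continuous : clear implicits.

Lemma bopP (S T : bounded_op) : S =1 T -> S = T.
Proof.
case: S T => [f fl fc] [g gl gc] /= /funext fg; subst g.
by congr BoundedOp; exact: Prop_irrelevance.
Qed.

HB.instance Definition _ (T : bounded_op) :=
  GRing.isLinear.Build R[i] H H *:%R T (bop_linear T).

HB.instance Definition _ := gen_eqMixin bounded_op.
HB.instance Definition _ := gen_choiceMixin bounded_op.

Fact bop0_linear : linear (fun _ : H => 0 : H).
Proof. by move=> a x y /=; rewrite scaler0 addr0. Qed.
Definition bop0 := BoundedOp bop0_linear (@cst_continuous H H 0).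

Fact bopN_linear (T : bounded_op) : linear (fun x => - T x).
Proof. by move=> a x y; rewrite linearP opprD scalerN. Qed.
Fact bopN_continuous (T : bounded_op) : continuous (fun x => - T x).
Proof. by move=> x; apply: cvgN; exact: (bop_continuous T). Qed.
Definition bopN T := BoundedOp (@bopN_linear T) (@bopN_continuous T).

Fact bopD_linear (S T : bounded_op) : linear (fun x => S x + T x).
Proof. by move=> a x y; rewrite !linearP scalerDr addrACA. Qed.
Fact bopD_continuous (S T : bounded_op) : continuous (fun x => S x + T x).
Proof.
move=> x; apply: cvgD; [exact: (bop_continuous S)|exact: (bop_continuous T)].
Qed.
Definition bopD S T := BoundedOp (@bopD_linear S T) (@bopD_continuous S T).

Fact bopZ_linear (c : R[i]) (T : bounded_op) : linear (fun x => c *: T x).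
Proof.
by move=> a x y; rewrite linearP scalerDr !scalerA (mulrC c a).
Qed.
Fact bopZ_continuous (c : R[i]) (T : bounded_op) : continuous (fun x => c *: T x).
Proof. by move=> x; apply: cvgZr; exact: (bop_continuous T). Qed.
Definition bopZ c T := BoundedOp (@bopZ_linear c T) (@bopZ_continuous c T).

Fact bop1_linear : linear (fun x : H => x).
Proof. by []. Qed.
Fact bop1_continuous : continuous (fun x : H => x).
Proof. by move=> x; exact: cvg_id. Qed.
Definition bop1 := BoundedOp bop1_linear bop1_continuous.

Fact bopM_linear (S T : bounded_op) : linear (fun x => S (T x)).
Proof. by move=> a x y; rewrite !linearP. Qed.
Fact bopM_continuous (S T : bounded_op) : continuous (fun x => S (T x)).
Proof.
move=> x; apply: continuous_comp; [exact: (bop_continuous T)|].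
exact: (bop_continuous S).
Qed.
Definition bopM S T := BoundedOp (@bopM_linear S T) (@bopM_continuous S T).

Fact bopDA : associative bopD.
Proof. by move=> S T U; apply: bopP => x /=; rewrite addrA. Qed.
Fact bopDC : commutative bopD.
Proof. by move=> S T; apply: bopP => x /=; rewrite addrC. Qed.
Fact bop0D : left_id bop0 bopD.
Proof. by move=> T; apply: bopP => x /=; rewrite add0r. Qed.
Fact bopND : left_inverse bop0 bopN bopD.
Proof. by move=> T; apply: bopP => x /=; rewrite addNr. Qed.
HB.instance Definition _ :=
  GRing.isZmodule.Build bounded_op bopDA bopDC bop0D bopND.

Fact bopMA : associative bopM.
Proof. by move=> S T U; exact: bopP. Qed.
Fact bop1M : left_id bop1 bopM.
Proof. by move=> T; exact: bopP. Qed.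
Fact bopM1 : right_id bop1 bopM.
Proof. by move=> T; exact: bopP. Qed.
Fact bopMDl : left_distributive bopM +%R.
Proof. by move=> S T U; exact: bopP. Qed.
Fact bopMDr : right_distributive bopM +%R.
Proof. by move=> S T U; apply: bopP => x /=; rewrite linearD. Qed.
(* A ring without the axiom 1 != 0, since H may be the zero space. *)
HB.instance Definition _ :=
  GRing.Zmodule_isPzRing.Build bounded_op bopMA bop1M bopM1 bopMDl bopMDr.

Fact bopZA a b (T : bounded_op) : bopZ a (bopZ b T) = bopZ (a * b) T.
Proof. by apply: bopP => x /=; rewrite scalerA. Qed.
Fact bop1Z : left_id 1 bopZ.
Proof. by move=> T; apply: bopP => x /=; rewrite scale1r. Qed.
Fact bopZDr : right_distributive bopZ +%R.
Proof. by move=> a S T; apply: bopP => x /=; rewrite scalerDr. Qed.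
Fact bopZDl (T : bounded_op) : {morph bopZ^~ T : a b / a + b}.
Proof. by move=> a b; apply: bopP => x /=; rewrite scalerDl. Qed.
HB.instance Definition _ :=
  GRing.Zmodule_isLmodule.Build R[i] bounded_op bopZA bop1Z bopZDr bopZDl.

Lemma bop_scalerAl (a : R[i]) (S T : bounded_op) : a *: (S * T) = (a *: S) * T.
Proof. exact: bopP. Qed.

Lemma bop_scalerAr (a : R[i]) (S T : bounded_op) : a *: (S * T) = S * (a *: T).
Proof. by apply: bopP => x /=; rewrite linearZ. Qed.

Definition is_adjoint (T S : bounded_op) : Prop :=
  forall x y : H, inner (T x) y = inner x (S y).

(* By the Riesz representation theorem every operator has an adjoint, so the
   default value 0 is never used. *)
Definition adjoint (T : bounded_op) : bounded_op :=
  xget 0 [set S | is_adjoint T S].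

Lemma is_adjoint_unique (T S1 S2 : bounded_op) :
  is_adjoint T S1 -> is_adjoint T S2 -> S1 = S2.
Proof.
move=> T1 T2; apply: bopP => y; apply/eqP; rewrite -subr_eq0 -normr_eq0.
by rewrite -sqrf_eq0 inner_normE linearBr /= -T1 -T2 subrr.
Qed.

Lemma adjointE (T S : bounded_op) : is_adjoint T S -> adjoint T = S.
Proof.
move=> TS; rewrite /adjoint; case: xgetP => [U _ TU|/(_ S)/(_ TS)//].
exact: is_adjoint_unique TU TS.
Qed.

(* The order of R[i] has 0 <= z exactly when z is real and nonnegative. *)
Definition positive_op (T : bounded_op) : Prop :=
  forall x : H, 0 <= inner (T x) x.

Definition projection (e : bounded_op) : Prop := adjoint e = e /\ e * e = e.

Definition partial_isometry (v : bounded_op) : Prop :=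
  projection (adjoint v * v).

Definition unitary (u : bounded_op) : Prop :=
  adjoint u * u = 1 /\ u * adjoint u = 1.

End BoundedOperators.

Arguments bounded_op {R} H.

(** * The sigma-weak topology on B(H)

    It is the coarsest topology making the functionals
    [T |-> \sum_n inner (T (xi n)) (eta n)] continuous, where [xi] and [eta]
    range over the square-summable sequences of vectors. The scalar field
    carries its usual topology as the normed module [R[i]^o] over itself. *)

Section SigmaWeak.
Variables (R : realType) (H : hilbertType R).

Definition square_summable : set (nat -> H) :=
  [set xi | cvgn (series (fun n => `|xi n| ^+ 2 : R[i]^o))].

Definition sigma_weak_functional (p : square_summable * square_summable)
    (T : bounded_op H) : R[i]^o :=
  limn (series (fun n => inner (T (\val p.1 n)) (\val p.2 n) : R[i]^o)).

Definition sigma_weak : Type :=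
  initial_topology (fun T : bounded_op H =>
    (sigma_weak_functional^~ T :
      {ptws square_summable * square_summable -> R[i]^o})).

HB.instance Definition _ := Topological.on sigma_weak.

End SigmaWeak.

Arguments sigma_weak {R} H.

(** * Von Neumann algebras, normal maps and states *)

Section VonNeumann.
Variables (R : realType) (H : hilbertType R).
Implicit Types (M A : set (bounded_op H)).

Definition commutant A : set (bounded_op H) :=
  [set T | forall S, A S -> T * S = S * T].

(* A self-adjoint set of operators equal to its bicommutant; such a set is a
   subalgebra of B(H) containing the identity operator. *)
Record von_neumann_algebra M : Prop := VonNeumannAlgebra {
  vna_adjoint : forall T, M T -> exists2 S, M S & is_adjoint T S;
  vna_bicommutant : commutant (commutant M) = M
}.

(* Maps on M and functionals on M are represented by functions on B(H), of
   which only the values on M matter. *)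

Definition normal_map M (F : bounded_op H -> bounded_op H) : Prop :=
  {within (M : set (sigma_weak H)),
    continuous (F : sigma_weak H -> sigma_weak H)}.

Definition normal_functional M (f : bounded_op H -> R[i]) : Prop :=
  {within (M : set (sigma_weak H)), continuous (f : sigma_weak H -> R[i]^o)}.

Record normal_positive_unital M (F : bounded_op H -> bounded_op H) : Prop :=
  NormalPositiveUnital {
    npu_stable : forall x, M x -> M (F x);
    npu_linear : forall (a : R[i]) x y, M x -> M y ->
      F (a *: x + y) = a *: F x + F y;
    npu_normal : normal_map M F;
    npu_positive : forall x, M x -> positive_op x -> positive_op (F x);
    npu_unital : F 1 = 1
  }.

Record normal_faithful_state M (w : bounded_op H -> R[i]) : Prop :=
  NormalFaithfulState {
    nfs_linear : forall (a : R[i]) x y, M x -> M y ->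
      w (a *: x + y) = a * w x + w y;
    nfs_positive : forall x, M x -> positive_op x -> 0 <= w x;
    nfs_unital : w 1 = 1;
    nfs_normal : normal_functional M w;
    nfs_faithful : forall x, M x -> positive_op x -> w x = 0 -> x = 0
  }.

End VonNeumann.

(** * Semigroups indexed by the natural numbers or the nonnegative reals *)

Inductive time := DiscreteTime | ContinuousTime.

Definition time_type (R : realType) (G : time) : Type :=
  match G with
  | DiscreteTime => nat
  | ContinuousTime => {nonneg R}
  end.

Definition time_add (R : realType) (G : time) :
    time_type R G -> time_type R G -> time_type R G :=
  match G with
  | DiscreteTime => fun m n : nat => (m + n)%N
  | ContinuousTime => fun s t : {nonneg R} => (s%:num + t%:num)%:nng
  end.

Definition cis (R : realType) (t : R) : R[i] := Complex (cos t) (sin t).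

(* [powers l chi] says that [chi] is the map g |-> l^g; in continuous time this
   means g |-> exp(i theta g) for some theta such that l = exp(i theta). *)
Definition powers (R : realType) (G : time) (l : R[i]) :
    (time_type R G -> R[i]) -> Prop :=
  match G with
  | DiscreteTime => fun chi : nat -> R[i] => forall n, chi n = l ^+ n
  | ContinuousTime => fun chi : {nonneg R} -> R[i] =>
      exists theta : R, l = cis theta /\
        forall t : {nonneg R}, chi t = cis (theta * t%:num)
  end.

(* In discrete time the semigroup consists of the iterates of Phi 1, so Phi 0 is
   the identity; in continuous time nothing is asked of Phi 0 beyond the
   semigroup law. *)
Definition starts_at_identity (R : realType) (H : hilbertType R) (G : time)
    (M : set (bounded_op H)) :
    (time_type R G -> bounded_op H -> bounded_op H) -> Prop :=
  match G with
  | DiscreteTime => fun Phi : nat -> _ => forall x, M x -> Phi 0%N x = x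
  | ContinuousTime => fun _ => True
  end.

Section Semigroups.
Variables (R : realType) (H : hilbertType R) (G : time).
Variables (M : set (bounded_op H)).
Variables (Phi : time_type R G -> bounded_op H -> bounded_op H).

Definition semigroup : Prop :=
  (forall g h x, M x -> Phi (time_add g h) x = Phi g (Phi h x)) /\
  starts_at_identity M Phi.

Definition semigroup_eigenspace (chi : time_type R G -> R[i]) :
    set (bounded_op H) :=
  [set x | M x /\ forall g, Phi g x = chi g *: x].

Definition semigroup_eigenvalue (chi : time_type R G -> R[i]) : Prop :=
  exists2 x, semigroup_eigenspace chi x & x <> 0.

Definition fixed_points : set (bounded_op H) :=
  [set y | M y /\ forall g, Phi g y = y].

Definition ergodic : Prop :=
  fixed_points = [set c *: (1 : bounded_op H) | c in [set: R[i]]].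

End Semigroups.

(* Main.v *)
Require Import Defs.
From HB Require Import structures.
From mathcomp Require Import all_boot all_order all_algebra.
From mathcomp Require Import complex.
From mathcomp Require Import all_classical all_reals all_analysis.
From mathcomp Require Import ring lra.
From Stdlib Require Ncring_tac.

Import Order.TTheory GRing.Theory Num.Theory.
Import numFieldNormedType.Exports.

Local Open Scope classical_set_scope.
Local Open Scope ring_scope.
Set Implicit Arguments.
Unset Strict Implicit.
Unset Printing Implicit Defensive.

(** Put [a = x^* x]. The whole argument rests on Kadison's inequality
    [F (y * y) >= F y * F y] for self-adjoint [y] and positive unital [F]
    ([kadison]), proved by means of Bernstein polynomials in [y]. It gives the
    Jordan-Schwarz inequality: the sesquilinear defect
    [F {y^*, z} - {F y^*, F z}], where [{y, z} = y z + z y], is nonnegative on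
    the diagonal ([jordan_schwarz]). On an eigenvector the diagonal defect is a
    positive operator killed by the faithful invariant state, so it vanishes,
    and then Cauchy-Schwarz makes the map multiplicative for [{x, -}] and
    [{x^*, -}] ([jdefect_eq0], [eigenspace_jordan]). Eigenvectors with unimodular
    eigenvalues are thus closed under the Jordan product, their eigenvalues
    multiplying.

    Hence [{x^*, x}] and [{(x^2)^*, x^2}] are fixed points, that is, scalars [c]
    and [d] by ergodicity. The first scalar gives [x a = (c - a) x], and the
    second then says [c a - a^2 = d / 2]: the operator [a] satisfies a quadratic
    equation with nonnegative real roots [s >= t]. If [s = t], then [a] is a
    scalar and [x] a multiple of a unitary; otherwise [a] is a combination of two
    complementary projections [e] and [1 - e]. As [x] exchanges these projections, [x e] and [x (1 - e)] are
    multiples of the partial isometries sought; they lie in the eigenspace since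
    [x a] is a combination of [x] and [{x^*, x^2}]. The three possibilities are
    [0 = t < s], [0 < t < s] and [t = s] ([decomposition]). *)

(** * Identities in noncommutative rings *)

(* These instances make the noncommutative ring normalizer of the standard
   library act on the ring operations, in particular on operators. *)
#[local] Instance pz_ops (A : pzRingType) :
  @Ncring.Ring_ops A 0 1 +%R *%R (fun x y => x - y) -%R (@eq A) := {}.

#[local] Instance pz_ring (A : pzRingType) : Ncring.Ring (Ro := pz_ops A).
Proof.
split; rewrite /Algebra_syntax.equality /Algebra_syntax.addition /=.
- exact: Corelib.Classes.RelationClasses.eq_equivalence.
- by move=> ? ? -> ? ? ->.
- by move=> ? ? -> ? ? ->.
- by move=> ? ? -> ? ? ->.
- by move=> ? ? ->.
- exact: add0r.
- exact: addrC.
- exact: addrA.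
- exact: mul1r.
- exact: mulr1.
- exact: mulrA.
- exact: mulrDl.
- by move=> *; exact: mulrDr.
- by [].
- exact: subrr.
Qed.

#[local] Instance bop_ops (R : realType) (H : hilbertType R) :
  Ncring.Ring_ops := @pz_ops (bounded_op H).
#[local] Instance bop_ring (R : realType) (H : hilbertType R) :
  Ncring.Ring := @pz_ring (bounded_op H).

Ltac ncring := Ncring_tac.non_commutative_ring.

(** * Inner products, adjoints and positive operators *)

Section Operators.
Context {R : realType} {H : hilbertType R}.
Implicit Types (x y z : H) (S T P : bounded_op H) (c : R[i]).

Lemma innerDl z x y : inner (x + y) z = inner x z + inner y z.
Proof. by rewrite linearDl. Qed.

Lemma innerDr z x y : inner z (x + y) = inner z x + inner z y.
Proof. by rewrite linearDr. Qed.

Lemma innerZl z c x : inner (c *: x) z = c * inner x z.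
Proof. by rewrite linearZl_LR. Qed.

Lemma innerZr z c x : inner z (c *: x) = c^* * inner z x.
Proof. by rewrite linearZr_LR. Qed.

Lemma innerNl z x : inner (- x) z = - inner x z.
Proof. by rewrite linearNl. Qed.

Lemma innerNr z x : inner z (- x) = - inner z x.
Proof. by rewrite linearNr. Qed.

Lemma innerC x y : inner y x = (inner x y)^*.
Proof. by rewrite hermC expr0 mul1r. Qed.

Lemma inner_ge0 x : 0 <= inner x x.
Proof. by rewrite -inner_normE exprn_ge0. Qed.

Lemma inner_eq0 x : inner x x = 0 -> x = 0.
Proof. by move/eqP; rewrite -inner_normE sqrf_eq0 normr_eq0 => /eqP. Qed.

Lemma bopDE S T x : (S + T) x = S x + T x. Proof. by []. Qed.
Lemma bopNE T x : (- T) x = - T x. Proof. by []. Qed.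
Lemma bopME S T x : (S * T) x = S (T x). Proof. by []. Qed.
Lemma bopZE c T x : (c *: T) x = c *: T x. Proof. by []. Qed.
Lemma bop1E x : (1 : bounded_op H) x = x. Proof. by []. Qed.
Lemma bop0E x : (0 : bounded_op H) x = 0. Proof. by []. Qed.

Definition bopE := (bopDE, bopNE, bopME, bopZE, bop1E, bop0E).

Definition innerE :=
  (bopE, innerDl, innerDr, innerZl, innerZr, innerNl, innerNr).

Lemma bop_inner_ext S T :
  (forall x y, inner (S x) y = inner (T x) y) -> S = T.
Proof.
move=> ST; apply: bopP => x; apply/eqP; rewrite -subr_eq0; apply/eqP.
by apply: inner_eq0; rewrite innerDl innerNl ST subrr.
Qed.

Lemma is_adjoint_sym S T : is_adjoint S T -> is_adjoint T S.
Proof. by move=> ST x y; rewrite innerC -ST -innerC. Qed.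

Lemma is_adjointD S S' T T' :
  is_adjoint S S' -> is_adjoint T T' -> is_adjoint (S + T) (S' + T').
Proof. by move=> SS TT x y; rewrite !innerE SS TT. Qed.

Lemma is_adjointN S S' : is_adjoint S S' -> is_adjoint (- S) (- S').
Proof. by move=> SS x y; rewrite !innerE SS. Qed.

Lemma is_adjointZ c S S' : is_adjoint S S' -> is_adjoint (c *: S) (c^* *: S').
Proof. by move=> SS x y; rewrite !innerE SS conjCK. Qed.

Lemma is_adjointZ_real c S S' :
  c \is Num.real -> is_adjoint S S' -> is_adjoint (c *: S) (c *: S').
Proof. by move=> /CrealP cr /(is_adjointZ c); rewrite cr. Qed.

Lemma is_adjointM S S' T T' :
  is_adjoint S S' -> is_adjoint T T' -> is_adjoint (S * T) (T' * S').
Proof. by move=> SS TT x y; rewrite !bopE SS TT. Qed.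

(** Testing on [c = 1] and [c = 'i] suffices; this is the scalar core of every
    polarization argument below. *)
Lemma conj_comb_eq0 (p q : R[i]) : (forall c, c^* * p + c * q = 0) -> p = 0.
Proof.
move=> pq; have pq1 := pq 1; have qp := pq 'i; move: pq1 qp.
rewrite conjC1 conjCi => pq1 qp.
have pE : p + p = 0.
  have -> : p + p = (1 * p + 1 * q) + 'i * (- 'i * p + 'i * q) +
    ('i ^+ 2 + 1) * (p - q) by ring.
  by rewrite pq1 qp sqrCi addNr mulr0 mul0r !addr0.
by have /eqP := pE; rewrite -mulr2n mulrn_eq0 => /eqP.
Qed.

Lemma inner_polar c T x y :
  inner (T (x + c *: y)) (x + c *: y) =
  inner (T x) x + (c^* * inner (T x) y + c * inner (T y) x) +
  c * c^* * inner (T y) y.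
Proof. by rewrite (linearD T) (linearZ_LR T) !innerE; ring. Qed.

(** Specific to complex scalars: the quadratic form determines the operator. *)
Lemma bop_quad_eq0 T : (forall x, inner (T x) x = 0) -> T = 0.
Proof.
move=> T0; apply: bop_inner_ext => x y; rewrite bopE linear0l.
apply: (@conj_comb_eq0 _ (inner (T y) x)) => c.
by have := inner_polar c T x y; rewrite !T0 mulr0 add0r addr0 => <-.
Qed.

(** The quadratic form is real, so it coincides with its conjugate; polarization
    extends the coincidence to the sesquilinear forms. *)
Lemma positive_selfadjoint T : positive_op T -> is_adjoint T T.
Proof.
move=> T0 x y.
have real z : (inner (T z) z)^* = inner (T z) z.
  by apply/CrealP; rewrite realE T0.
apply/eqP; rewrite -subr_eq0 (innerC (T y)); apply/eqP.
apply: (@conj_comb_eq0 _ (inner (T y) x - (inner (T x) y)^*)) => c.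
have := real (x + c *: y).
rewrite inner_polar !rmorphD /= !rmorphM /= !real !conjCK => /eqP.
rewrite -subr_eq0 => /eqP/(congr1 -%R); rewrite oppr0 => <-.
ring.
Qed.

Lemma positive_opD S T : positive_op S -> positive_op T -> positive_op (S + T).
Proof. by move=> S0 T0 x; rewrite !innerE addr_ge0. Qed.

Lemma positive_opZ c T : 0 <= c -> positive_op T -> positive_op (c *: T).
Proof. by move=> c0 T0 x; rewrite !innerE mulr_ge0. Qed.

Lemma positive_op_conj S S' T :
  is_adjoint S S' -> positive_op T -> positive_op (S' * T * S).
Proof.
by move=> SS T0 x; rewrite !bopE (is_adjoint_sym SS).
Qed.

Lemma positive_op1 : positive_op (1 : bounded_op H).
Proof. exact: inner_ge0. Qed.

Lemma positive_op_sqr S S' : is_adjoint S S' -> positive_op (S' * S).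
Proof.
by move=> /positive_op_conj/(_ positive_op1); rewrite mulr1.
Qed.

Lemma sqr_op_eq0 S S' : is_adjoint S S' -> S' * S = 0 -> S = 0.
Proof.
move=> SS S0; apply: bopP => x; apply: inner_eq0.
by rewrite SS -bopME S0 linear0r.
Qed.

Lemma positive_scalar c :
  (1 : bounded_op H) <> 0 -> positive_op (c *: (1 : bounded_op H)) -> 0 <= c.
Proof.
move=> H1 c0; have [x x0] : exists x : H, x != 0.
  apply: contrapT => Hx; apply: H1; apply: bopP => x; rewrite !bopE.
  by apply/eqP; apply: contrapT => /negP x0; apply: Hx; exists x.
have := c0 x; rewrite !innerE -inner_normE pmulr_lge0 //.
by rewrite exprn_gt0 // normr_gt0.
Qed.

(** Every self-adjoint operator becomes positive after adding a scalar; this is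
    how statements about positive operators reach self-adjoint ones. *)
Lemma selfadjoint_bound T : is_adjoint T T ->
  exists2 k : R[i], 0 < k &
    positive_op (k *: (1 : bounded_op H) + T) /\
    positive_op (k *: (1 : bounded_op H) - T).
Proof.
move=> TT.
have /linear_boundedP[r [rr /(_ (`|r| + 1))]] :=
  continuous_linear_bounded 0 (@bop_continuous _ _ T 0).
have r_lt : r < `|r| + 1.
  by rewrite (le_lt_trans (real_ler_norm rr)) // ltrDl.
set k := `|r| + 1 => /(_ r_lt) Tk.
have k0 : 0 < k by rewrite ltr_wpDl.
have kr : k \is Num.real by exact: gtr0_real.
(* 0 <= |c k x + T x|^2 with |T x| <= k |x| bounds c<T x, x> from below *)
have bound c x : c ^+ 2 = 1 -> c^* = c ->
    0 <= inner ((k *: (1 : bounded_op H) + c *: T) x) x.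
  move=> c2 cc; have := inner_ge0 ((c * k) *: x + T x).
  rewrite !innerE rmorphM /= cc (CrealP kr) -(TT x x) => sq.
  have Tx : inner (T x) (T x) <= k ^+ 2 * inner x x.
    rewrite -!inner_normE -exprMn; apply: lerXn2r; last exact: Tk.
      by rewrite nnegrE.
    by rewrite nnegrE mulr_ge0 // ltW.
  rewrite -(pmulr_rge0 _ (_ : 0 < k *+ 2)) ?pmulrn_lgt0 //.
  apply: le_trans sq _.
  move: Tx; rewrite -subr_ge0 => Tx; rewrite -subr_ge0.
  have -> : k *+ 2 * (k * inner x x + c * inner (T x) x) -
    (c * k * (c * k * inner x x + inner (T x) x) +
     (c * k * inner (T x) x + inner (T x) (T x))) =
    (k ^+ 2 * inner x x - inner (T x) (T x)) +
      (1 - c ^+ 2) * k ^+ 2 * inner x x by ring.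
  by rewrite c2 subrr !mul0r addr0.
exists k => //; split=> x.
  by have := bound 1 x (expr1n _ _) (conjC1 _); rewrite scale1r.
have := bound (-1) x; rewrite sqrrN expr1n scaleN1r; apply=> //.
exact: (rmorphN1 Num.conj).
Qed.

End Operators.

(** * Closure properties of a von Neumann algebra *)

Section VonNeumannAlgebra.
Context {R : realType} {H : hilbertType R} {M : set (bounded_op H)}.
Hypothesis hM : von_neumann_algebra M.
Implicit Types (x y : bounded_op H) (c : R[i]).

Lemma vna1 : M 1.
Proof.
by rewrite -(vna_bicommutant hM) => S _; rewrite mul1r mulr1.
Qed.

Lemma vnaM x y : M x -> M y -> M (x * y).
Proof.
rewrite -(vna_bicommutant hM) => Mx My S /[dup] /Mx xS /My yS.
by rewrite -mulrA yS mulrA xS mulrA.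
Qed.

Lemma vnaD x y : M x -> M y -> M (x + y).
Proof.
rewrite -(vna_bicommutant hM) => Mx My S /[dup] /Mx xS /My yS.
by rewrite mulrDl mulrDr xS yS.
Qed.

Lemma vnaZ c x : M x -> M (c *: x).
Proof.
rewrite -(vna_bicommutant hM) => Mx S /Mx xS.
by rewrite -bop_scalerAl -bop_scalerAr xS.
Qed.

Lemma vna0 : M 0.
Proof. by rewrite -(scale0r (1 : bounded_op H)); exact/vnaZ/vna1. Qed.

Lemma vnaN x : M x -> M (- x).
Proof. by rewrite -scaleN1r; exact: vnaZ. Qed.

Lemma vnaB x y : M x -> M y -> M (x - y).
Proof. by move=> Mx /vnaN; exact: vnaD. Qed.

Lemma vnaX x n : M x -> M (x ^+ n).
Proof.
move=> Mx; elim: n => [|n IH]; first exact: vna1.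
by rewrite exprS; exact: vnaM.
Qed.

Lemma vna_is_adjoint x : M x -> is_adjoint x (adjoint x).
Proof. by move=> /(vna_adjoint hM)[y _ xy]; rewrite (adjointE xy). Qed.

Lemma vna_adjoint_mem x : M x -> M (adjoint x).
Proof. by move=> /(vna_adjoint hM)[y My xy]; rewrite (adjointE xy). Qed.

End VonNeumannAlgebra.

(** * Kadison's inequality *)

(** Replaces the passage to the limit in [0 <= w / n + v]; [v] and [w] may be
    complex, the order forcing the imaginary part of [v] to vanish. *)
Lemma lim_scalar_ge0 {R : realType} (v w : R[i]) :
  (forall n, 0 <= w + n.+1%:R * v) -> 0 <= v.
Proof.
case: v => v v'; case: w => w w' vw.
have v'0 : v' = 0.
  have := vw 0%N; have := vw 1%N; rewrite !mulr_natl !mulrS !mulr0n !addr0.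
  rewrite !lecE /= => /andP[/eqP e2 _] /andP[/eqP e1 _].
  lra.
rewrite v'0 lecE /= eqxx /= leNgt; apply/negP => v0.
have := vw (Num.Def.archi_bound (`|w| / - v)).
set n := Num.Def.archi_bound _; have : `|w| / - v < n%:R.
  by apply: archi_boundP; rewrite divr_ge0 // oppr_ge0 ltW.
rewrite ltr_pdivrMr ?oppr_gt0 // => wn.
rewrite -(rmorph_nat (real_complex R)) lecE => /andP[_] /=.
by have := ler_norm w; rewrite mul0r subr0 (mulrS 1) mulrDl mul1r; lra.
Qed.

Section Kadison.
Context {R : realType} {H : hilbertType R} {M : set (bounded_op H)}.
Context {F : bounded_op H -> bounded_op H}.
Hypothesis hM : von_neumann_algebra M.
Hypothesis hF : normal_positive_unital M F.
Implicit Types (a b x y : bounded_op H) (c : R[i]).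

Lemma npuD x y : M x -> M y -> F (x + y) = F x + F y.
Proof. by move=> Mx My; have := npu_linear hF 1 Mx My; rewrite !scale1r. Qed.

Lemma npu0 : F 0 = 0.
Proof.
have M0 := vna0 hM.
by apply: (addrI (F 0)); rewrite -npuD // !addr0.
Qed.

Lemma npuZ c x : M x -> F (c *: x) = c *: F x.
Proof.
move=> Mx; have M0 := vna0 hM.
by have := npu_linear hF c Mx M0; rewrite npu0 !addr0.
Qed.

Lemma npuN x : M x -> F (- x) = - F x.
Proof. by move=> Mx; rewrite -scaleN1r npuZ // scaleN1r. Qed.

Lemma npuB x y : M x -> M y -> F (x - y) = F x - F y.
Proof. by move=> Mx My; rewrite npuD ?npuN //; exact: vnaN. Qed.

Lemma npu_selfadjoint a : M a -> is_adjoint a a -> is_adjoint (F a) (F a).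
Proof.
move=> Ma aa; have [k k0 [ka _]] := selfadjoint_bound aa.
have Mk := vnaZ hM k (vna1 hM).
have -> : F a = F (k *: (1 : bounded_op H) + a) - k *: (1 : bounded_op H).
  rewrite (npuD Mk Ma) (npuZ k (vna1 hM)) (npu_unital hF).
  by rewrite [RHS]addrAC subrr add0r.
apply: is_adjointD.
  by apply/positive_selfadjoint/(npu_positive hF) => //; exact: vnaD.
by apply: is_adjointN; apply: is_adjointZ_real => //; exact: gtr0_real.
Qed.

(** A positive map preserves self-adjointness of [x + x^*] and [i x - i x^*],
    and these two operators determine [x] and [x^*]. *)
Lemma npu_adjoint x y : M x -> M y -> is_adjoint x y -> is_adjoint (F x) (F y).
Proof.
move=> Mx My xy; have yx := is_adjoint_sym xy.
have s1 : is_adjoint (F (x + y)) (F (x + y)).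
  apply: npu_selfadjoint; first exact: vnaD.
  by rewrite {2}addrC; exact: is_adjointD.
have s2 : is_adjoint (F ('i *: (x - y))) (F ('i *: (x - y))).
  apply: npu_selfadjoint; first exact/vnaZ/vnaB.
  have -> : 'i *: (x - y) = 'i *: x + 'i^* *: y.
    by rewrite conjCi scaleNr scalerBr.
  have := is_adjointD (is_adjointZ 'i xy) (is_adjointZ 'i^* yx).
  by rewrite conjCK [X in is_adjoint _ X]addrC.
move=> u v; have := s1 u v; have := s2 u v.
rewrite npuZ ?npuB ?npuD //; last exact: vnaB.
rewrite !innerE conjCi => e2 e1.
apply: (@mulfI _ 2%:R); first by rewrite pnatr_eq0.
have i2 : 'i * 'i = -1 :> R[i] by rewrite -expr2 sqrCi.
have e3 := congr1 ( *%R (- 'i)) e2.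
have -> : 2 * inner (F x u) v = (inner (F x u) v + inner (F y u) v) +
   - 'i * ('i * (inner (F x u) v - inner (F y u) v)) +
   (1 + 'i * 'i) * (inner (F x u) v - inner (F y u) v) by ring.
rewrite e1 e3 i2 subrr mul0r addr0 mulrA mulrNN i2.
ring.
Qed.

(** The terms of the Bernstein polynomials, up to binomial coefficients: for
    [0 <= a <= 1] they give a partition of the identity into positive operators
    inside the algebra, in the role that spectral projections usually play. *)
Definition bernstein a i j : bounded_op H := a ^+ i * (1 - a) ^+ j.

Lemma bernstein_mem a i j : M a -> M (bernstein a i j).
Proof.
move=> Ma; have M1 := vna1 hM; have Mb := vnaB hM M1 Ma.
by apply: (vnaM hM); exact: (vnaX hM).
Qed.

Lemma bernstein_comm a j : a * (1 - a) ^+ j = (1 - a) ^+ j * a.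
Proof. by apply: commrX; rewrite /GRing.comm mulrBl mulrBr mul1r mulr1. Qed.

Lemma bernsteinSl a i j : bernstein a i.+1 j = bernstein a i j * a.
Proof. by rewrite /bernstein exprSr -!mulrA bernstein_comm. Qed.

Lemma bernsteinSr a i j :
  bernstein a i j.+1 = bernstein a i j - bernstein a i.+1 j.
Proof. by rewrite bernsteinSl /bernstein exprSr mulrA mulrBr mulr1. Qed.

(** Conjugation by [a] or [1 - a] raises an exponent by two, so only the
    exponents [0] and [1] remain; there
    [a (1 - a) = a (1 - a) a + (1 - a) a (1 - a)]. *)
Lemma bernstein_positive a i j : positive_op a -> positive_op (1 - a) ->
  positive_op (bernstein a i j).
Proof.
move=> a0 b0.
have aa := positive_selfadjoint a0; have bb := positive_selfadjoint b0.
have stepl k l : positive_op (bernstein a k l) ->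
    positive_op (bernstein a k.+2 l).
  move=> /(positive_op_conj aa); congr positive_op.
  by rewrite bernsteinSl /bernstein exprS !mulrA.
have stepr k l : positive_op (bernstein a k l) ->
    positive_op (bernstein a k l.+2).
  move=> /(positive_op_conj bb); congr positive_op.
  rewrite /bernstein (exprSr (1 - a)) (exprS (1 - a)) !mulrA; congr (_ * _ * _).
  by apply: commrX; rewrite /GRing.comm mulrBl mulrBr mul1r mulr1.
have col l : positive_op (bernstein a 0 l) -> positive_op (bernstein a 1 l) ->
    forall k, positive_op (bernstein a k l).
  move=> l0 l1 k; suff [] : positive_op (bernstein a k l) /\
    positive_op (bernstein a k.+1 l) by [].
  by elim: k => [|k [k0 k1]]; split => //; exact: stepl.
have c0 : forall k, positive_op (bernstein a k 0).
  by apply: col; rewrite /bernstein expr0 ?expr1 mulr1 //; exact: positive_op1.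
have c1 : forall k, positive_op (bernstein a k 1).
  apply: col; rewrite /bernstein ?expr0 ?expr1 ?mul1r //.
  have -> : a * (1 - a) = a * (1 - a) * a + (1 - a) * a * (1 - a).
    ncring.
  by apply: positive_opD; exact: positive_op_conj.
suff [] : positive_op (bernstein a i j) /\ positive_op (bernstein a i j.+1) by [].
by elim: j => [|j [j0 j1]]; split => //; exact: stepr.
Qed.

(** Let [c_k], [k <= n], be the Bernstein terms of degree [n] with their binomial
    coefficients, all multiplied by [bernstein a i j]. The bounded expression is
    the sum over [k] of the nonnegative numbers [<F c_k w, w>] with
    [w = (s + k) u - v]: the moments of the binomial law of parameter [a] are
    computed by the induction on [n], which splits a term [c] into [c a], with
    [s] raised by one, and [c (1 - a)]. *)
Lemma bernstein_form_ge0 a (n : nat) (s : R[i]) (u v : H) i j :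
  M a -> positive_op a -> positive_op (1 - a) -> s \is Num.real ->
  let f k (w z : H) := inner (F (bernstein a (i + k) j) w) z in
  0 <= s ^+ 2 * f 0%N u u + (2 * s * n%:R + n%:R) * f 1%N u u
         + (n%:R ^+ 2 - n%:R) * f 2%N u u
       - (s * f 0%N u v + n%:R * f 1%N u v)
       - (s * f 0%N v u + n%:R * f 1%N v u)
       + f 0%N v v.
Proof.
move=> Ma a0 b0 sr /=.
elim: n s sr i j => [|n IH] s sr i j.
  have c0 := bernstein_positive i j a0 b0.
  have := npu_positive hF (bernstein_mem i j Ma) c0 (s *: u - v).
  rewrite (linearB (F (bernstein a i j))) (linearZ_LR (F (bernstein a i j))).
  rewrite !innerE (CrealP sr) addn0.
  set t := (X in 0 <= X -> _) => t0; set t' := (X in 0 <= X).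
  by have -> : t' = t by rewrite /t /t'; ring.
have := addr_ge0 (IH _ (rpredD sr (rpred1 _)) i.+1 j) (IH _ sr i j.+1).
have FS k :
    F (bernstein a k j.+1) = F (bernstein a k j) - F (bernstein a k.+1 j).
  by rewrite bernsteinSr npuB //; exact: bernstein_mem.
rewrite !addSn !addnS !addn0 !FS !innerE -natr1.
set t := (X in 0 <= X -> _) => t0; set t' := (X in 0 <= X).
by have -> : t' = t by rewrite /t /t'; ring.
Qed.

(** With [v = n F(a) u] the binomial sum is [n^2] times the wanted quantity plus
    a term linear in [n], the variance of the Bernstein approximation. *)
Lemma kadison_unit_interval a : M a -> positive_op a -> positive_op (1 - a) ->
  positive_op (F (a * a) - F a * F a).
Proof.
move=> Ma a0 b0 u; have aa := npu_selfadjoint Ma (positive_selfadjoint a0).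
apply: (@lim_scalar_ge0 _ _ (inner (F a u) u - inner (F (a * a) u) u)) => n.
have := @bernstein_form_ge0 a n.+1 0 u (n.+1%:R *: F a u) 0 0 Ma a0 b0
  (rpred0 _).
rewrite /= !add0n /bernstein !expr0 expr1 (expr2 a) !mulr1 (npu_unital hF).
rewrite !(linearZ_LR (F a)) !innerE conjC_nat -(aa (F a u) u) => t0.
rewrite -(pmulr_rge0 _ (_ : 0 < n.+1%:R :> R[i])) ?ltr0Sn //.
set t := (X in 0 <= X) in t0; set t' := (X in 0 <= X).
by have -> : t' = t by rewrite /t /t'; ring.
Qed.

(** The difference is insensitive to adding a scalar to [a] and quadratic under
    scaling, so [a] may be replaced by [(a + k) / (2 k)], which lies between [0]
    and [1]. *)
Theorem kadison a : M a -> is_adjoint a a -> positive_op (F (a * a) - F a * F a).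
Proof.
move=> Ma aa; have [k k0 [ka ka']] := selfadjoint_bound aa.
have M1 := vna1 hM; have Mk := vnaZ hM k M1.
pose r : R[i] := (k *+ 2)^-1.
have r0 : 0 < r by rewrite invr_gt0 pmulrn_lgt0.
pose b := r *: (k *: (1 : bounded_op H) + a).
have Mb : M b by apply/(vnaZ hM)/vnaD.
have kr : k * r *+ 2 = 1 by rewrite -mulrnAl divff // gt_eqF // pmulrn_lgt0.
have b1 : 1 - b = r *: (k *: (1 : bounded_op H) - a).
  apply: bop_inner_ext => u v; rewrite /b !innerE.
  by rewrite -[X in X - _]mul1r -kr; ring.
have aE : a = (k *+ 2) *: b - k *: (1 : bounded_op H).
  apply: bop_inner_ext => u v; rewrite /b !innerE.
  transitivity (k * r *+ 2 * (k * inner u v + inner (a u) v) - k * inner u v).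
    by rewrite kr; ring.
  ring.
have b0 : positive_op b := positive_opZ (ltW r0) ka.
have b1' : positive_op (1 - b) by rewrite b1; exact: positive_opZ (ltW r0) ka'.
clearbody b.
have k2 : 0 <= (k *+ 2) ^+ 2 by rewrite exprn_ge0 // mulrn_wge0 // ltW.
have -> : F a = (k *+ 2) *: F b - k *: (1 : bounded_op H).
  by rewrite aE (npuB (vnaZ hM _ Mb) Mk) !npuZ // (npu_unital hF).
have := positive_opZ k2 (kadison_unit_interval Mb b0 b1').
congr positive_op.
have -> : a * a = (k *+ 2) ^+ 2 *: (b * b) - (k *+ 2 * k *+ 2) *: b +
    k ^+ 2 *: (1 : bounded_op H).
  rewrite {1 2}aE; apply: bop_inner_ext => u v.
  by rewrite !innerE (linearB b) !(linearZ_LR b) !innerE; ring.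
have [Mbb Mkb] := (vnaZ hM ((k *+ 2) ^+ 2) (vnaM hM Mb Mb),
  vnaZ hM (k *+ 2 * k *+ 2) Mb).
rewrite (npuD (vnaB hM Mbb Mkb) (vnaZ hM _ M1)) (npuB Mbb Mkb) !npuZ //;
  last exact: vnaM.
rewrite (npu_unital hF); apply: bop_inner_ext => u v.
by rewrite !innerE (linearB (F b)) !(linearZ_LR (F b)) !innerE; ring.
Qed.

End Kadison.

(** * The Jordan-Schwarz inequality *)

(** Twice the usual Jordan product. *)
Definition jordan {A : pzRingType} (x y : A) : A := x * y + y * x.

(** A real-affine function on the complex plane that is bounded below has no
    linear part. *)
Lemma affine_ge0_eq0 {R : realType} (r p q : R[i]) :
  (forall c, 0 <= r + (c^* * p + c * q)) -> p = 0.
Proof.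
move=> h; apply: (@conj_comb_eq0 _ p q) => c.
have ge0 c' : 0 <= c'^* * p + c' * q.
  apply: (@lim_scalar_ge0 _ _ r) => n; have := h (n.+1%:R * c').
  by rewrite rmorphM /= conjC_nat mulrDr !mulrA.
apply/eqP; rewrite eq_le ge0 andbT -oppr_ge0.
by have := ge0 (- c); rewrite rmorphN !mulNr opprD.
Qed.

Section JordanSchwarz.
Context {R : realType} {H : hilbertType R} {M : set (bounded_op H)}.
Context {F : bounded_op H -> bounded_op H}.
Hypothesis hM : von_neumann_algebra M.
Hypothesis hF : normal_positive_unital M F.
Implicit Types (a b x y z : bounded_op H) (c : R[i]).

Lemma vna_jordan x y : M x -> M y -> M (jordan x y).
Proof. by move=> Mx My; apply: (vnaD hM); exact: (vnaM hM). Qed.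

(** Measures how far [F] is from being a Jordan homomorphism. Kept bilinear: the
    sesquilinear form of interest is [fun y z => jdefect (adjoint y) z]. *)
Definition jdefect x y := F (jordan x y) - jordan (F x) (F y).

Lemma jdefectC x y : jdefect x y = jdefect y x.
Proof. by rewrite /jdefect /jordan !(addrC (_ * y)) (addrC (_ * F y)). Qed.

Lemma jdefectP c x y z : M x -> M y -> M z ->
  jdefect x (c *: y + z) = c *: jdefect x y + jdefect x z.
Proof.
move=> Mx My Mz; have Mxy := vna_jordan Mx My; have Mxz := vna_jordan Mx Mz.
rewrite /jdefect.
have -> : jordan x (c *: y + z) = c *: jordan x y + jordan x z.
  rewrite /jordan mulrDr mulrDl -bop_scalerAl -bop_scalerAr scalerDr.
  ncring.
rewrite !(npu_linear hF) //.
have -> : jordan (F x) (c *: F y + F z) =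
    c *: jordan (F x) (F y) + jordan (F x) (F z).
  rewrite /jordan mulrDr mulrDl -bop_scalerAl -bop_scalerAr scalerDr.
  ncring.
rewrite scalerBr; ncring.
Qed.

Lemma jdefectDr x y z : M x -> M y -> M z ->
  jdefect x (y + z) = jdefect x y + jdefect x z.
Proof. by move=> Mx My Mz; have := jdefectP 1 Mx My Mz; rewrite !scale1r. Qed.

Lemma jdefectZr c x y : M x -> M y -> jdefect x (c *: y) = c *: jdefect x y.
Proof.
move=> Mx My; have := jdefectP c Mx My (vna0 hM); rewrite addr0 => ->.
rewrite /jdefect /jordan !mulr0 !mul0r addr0 (npu0 hM hF) mulr0 mul0r.
by rewrite !addr0 subrr addr0.
Qed.

Lemma jdefectDl x y z : M x -> M y -> M z ->
  jdefect (y + z) x = jdefect y x + jdefect z x.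
Proof. by move=> *; rewrite jdefectC jdefectDr // !(jdefectC x). Qed.

Lemma jdefectZl c x y : M x -> M y -> jdefect (c *: y) x = c *: jdefect y x.
Proof. by move=> *; rewrite jdefectC jdefectZr // (jdefectC x). Qed.

Lemma jdefect_selfadjoint a : M a -> is_adjoint a a -> positive_op (jdefect a a).
Proof.
move=> Ma aa; have := kadison hM hF Ma aa; have Maa := vnaM hM Ma Ma.
move=> a0; have := positive_opD a0 a0; congr positive_op.
rewrite /jdefect /jordan (npuD hF Maa Maa).
ncring.
Qed.

(** The defects of the self-adjoint operators [x + x^*] and [i x - i x^*] add up
    to four times the defect of [x^*] and [x]. *)
Lemma jordan_schwarz x y : M x -> M y -> is_adjoint x y ->
  positive_op (jdefect y x).
Proof.
move=> Mx My xy; have yx := is_adjoint_sym xy.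
have Mix := vnaZ hM 'i Mx; have Miy := vnaZ hM 'i^* My.
have s1 : is_adjoint (x + y) (x + y).
  by rewrite {2}addrC; exact: is_adjointD.
have s2 : is_adjoint ('i *: x + 'i^* *: y) ('i *: x + 'i^* *: y).
  have := is_adjointD (is_adjointZ 'i xy) (is_adjointZ 'i^* yx).
  by rewrite conjCK [X in is_adjoint _ X]addrC.
have := positive_opD (jdefect_selfadjoint (vnaD hM Mx My) s1)
  (jdefect_selfadjoint (vnaD hM Mix Miy) s2).
have [Mxy Mixy] := (vnaD hM Mx My, vnaD hM Mix Miy).
rewrite !jdefectDr // !jdefectDl //.
rewrite !jdefectZl // !jdefectZr // (jdefectC x y) conjCi.
move: (jdefect x x) (jdefect y x) (jdefect y y) => P Q S PQS u.
rewrite -(pmulr_rge0 _ (_ : 0 < 4%:R :> R[i])) ?ltr0Sn //.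
have := PQS u; congr (0 <= _); rewrite !innerE.
transitivity (('i ^+ 2 + 1) * (inner (P u) u - inner (Q u) u *+ 2 +
  inner (S u) u) + 4%:R * inner (Q u) u); first by ring.
by rewrite sqrCi addNr mul0r add0r.
Qed.

(** The equality case of the Cauchy-Schwarz inequality for the positive forms
    [<jdefect x^* z u, u>] in [x] and [z]: expand the defect of [z + c x]. *)
Lemma jdefect_eq0 x y z : M x -> M y -> is_adjoint x y -> jdefect y x = 0 ->
  M z -> jdefect y z = 0.
Proof.
move=> Mx My xy yx0 Mz.
have Mzs := vna_adjoint_mem hM Mz; have zzs := vna_is_adjoint hM Mz.
apply: bop_quad_eq0 => u.
apply: (@affine_ge0_eq0 _ (inner (jdefect (adjoint z) z u) u) _
  (inner (jdefect (adjoint z) x u) u)) => c.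
have Mcx := vnaZ hM c Mx; have Mcy := vnaZ hM c^* My.
have := jordan_schwarz (vnaD hM Mz Mcx) (vnaD hM Mzs Mcy)
  (is_adjointD zzs (is_adjointZ c xy)) u.
rewrite jdefectDr ?jdefectDl //; last exact: vnaD.
rewrite !jdefectZl // !jdefectZr //.
rewrite yx0 !scaler0 addr0.
move: (jdefect (adjoint z) z) (jdefect y z) (jdefect (adjoint z) x) => P Q S.
by rewrite !innerE; congr (0 <= _); ring.
Qed.

End JordanSchwarz.

Arguments jdefect {R H} F x y.

(** * Eigenvectors of the semigroup *)

Section EigenOperators.
Context {R : realType} {H : hilbertType R} {M : set (bounded_op H)}.
Hypothesis hM : von_neumann_algebra M.
Implicit Types (x y z : bounded_op H) (c : R[i]).

Lemma npu_eigen_adjoint F c x : normal_positive_unital M F -> M x ->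
  F x = c *: x -> F (adjoint x) = c^* *: adjoint x.
Proof.
move=> hF Mx Fx; have xx := vna_is_adjoint hM Mx.
have := npu_adjoint hM hF Mx (vna_adjoint_mem hM Mx) xx.
by rewrite Fx => /is_adjoint_unique; apply; exact: is_adjointZ.
Qed.

(** As [|c| = 1], the defect is [F y - y] with [y = {x^*, x}]; it is positive and
    the invariant state vanishes on it, so faithfulness applies. *)
Lemma eigen_jdefect_eq0 F omega c x : normal_positive_unital M F ->
  normal_faithful_state M omega -> (forall y, M y -> omega (F y) = omega y) ->
  `|c| = 1 -> M x -> F x = c *: x -> jdefect F (adjoint x) x = 0.
Proof.
move=> hF hw hinv c1 Mx Fx; have Mxs := vna_adjoint_mem hM Mx.
have Mj := vna_jordan hM Mxs Mx.
have MFj := npu_stable hF Mj.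
have jE : jdefect F (adjoint x) x =
    -1 *: jordan (adjoint x) x + F (jordan (adjoint x) x).
  rewrite /jdefect Fx (npu_eigen_adjoint hF Mx Fx) scaleN1r addrC.
  congr (- _ + _).
  rewrite /jordan -!bop_scalerAl -!bop_scalerAr !scalerA (mulrC c).
  by rewrite mulrC -normCK c1 expr1n !scale1r.
apply: (nfs_faithful hw).
- by rewrite jE; exact/(vnaD hM)/MFj/vnaZ.
- exact: (jordan_schwarz hM hF Mx Mxs (vna_is_adjoint hM Mx)).
- by rewrite jE (nfs_linear hw) // hinv // mulN1r addNr.
Qed.

Context {G : time} {Phi : time_type R G -> bounded_op H -> bounded_op H}.
Context {omega : bounded_op H -> R[i]}.
Hypothesis hPhi : forall g, normal_positive_unital M (Phi g).
Hypothesis homega : normal_faithful_state M omega.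
Hypothesis hinv : forall g y, M y -> omega (Phi g y) = omega y.
Implicit Types chi psi : time_type R G -> R[i].

Lemma eigenspace_linear chi c x y : semigroup_eigenspace M Phi chi x ->
  semigroup_eigenspace M Phi chi y ->
  semigroup_eigenspace M Phi chi (c *: x + y).
Proof.
move=> [Mx xE] [My yE]; split=> [|g]; first exact/(vnaD hM)/My/vnaZ.
by rewrite (npu_linear (hPhi g)) // xE yE scalerDr !scalerA mulrC.
Qed.

Lemma eigenspaceZ chi c x : semigroup_eigenspace M Phi chi x ->
  semigroup_eigenspace M Phi chi (c *: x).
Proof.
move=> [Mx xE]; split=> [|g]; first exact: (vnaZ hM).
by rewrite (npuZ hM (hPhi g)) // xE !scalerA mulrC.
Qed.

Lemma eigenspace_adjoint chi x : semigroup_eigenspace M Phi chi x ->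
  semigroup_eigenspace M Phi (fun g => (chi g)^*) (adjoint x).
Proof.
move=> [Mx xE]; split=> [|g]; first exact: (vna_adjoint_mem hM).
exact: (npu_eigen_adjoint (hPhi g) Mx (xE g)).
Qed.

(** The vanishing defect of [x^*] and [x] is symmetric, so it also serves as the
    diagonal defect of the eigenvector [x^*]; Cauchy-Schwarz then gives
    multiplicativity in the form [F {x, y} = {F x, F y}]. *)
Lemma eigenspace_jordan chi psi x y : (forall g, `|chi g| = 1) ->
  semigroup_eigenspace M Phi chi x -> semigroup_eigenspace M Phi psi y ->
  semigroup_eigenspace M Phi (fun g => chi g * psi g) (jordan x y).
Proof.
move=> chi1 [Mx xE] [My yE]; split=> [|g]; first exact: (vna_jordan hM).
have Mxs := vna_adjoint_mem hM Mx.
have := eigen_jdefect_eq0 (hPhi g) homega (hinv g) (chi1 g) Mx (xE g).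
rewrite jdefectC => /(jdefect_eq0 hM (hPhi g) Mxs Mx
  (is_adjoint_sym (vna_is_adjoint hM Mx)))/(_ My)/eqP.
rewrite subr_eq0 => /eqP ->; rewrite xE yE.
rewrite /jordan -!bop_scalerAl -!bop_scalerAr !scalerA (mulrC (psi g)).
by rewrite scalerDr.
Qed.

Lemma eigenspace_square chi x : (forall g, `|chi g| = 1) ->
  semigroup_eigenspace M Phi chi x ->
  semigroup_eigenspace M Phi (fun g => chi g * chi g) (x * x).
Proof.
move=> chi1 xE; have jE := eigenspace_jordan chi1 xE xE.
suff <- : 2^-1 *: jordan x x = x * x by exact: eigenspaceZ.
rewrite /jordan -mulr2n -(scaler_nat 2 (x * x)).
by rewrite scalerA mulVf ?scale1r // pnatr_eq0.
Qed.

Lemma ergodic_square_sum chi x : ergodic M Phi -> (forall g, `|chi g| = 1) ->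
  semigroup_eigenspace M Phi chi x ->
  exists c, jordan (adjoint x) x = c *: (1 : bounded_op H).
Proof.
move=> herg chi1 xE.
have := eigenspace_jordan (fun g => _) (eigenspace_adjoint xE) xE.
case=> [g|Mj jE]; first by rewrite norm_conjC.
(* the eigenvalues of x^* and x are conjugate, so their product is 1 *)
have : fixed_points M Phi (jordan (adjoint x) x).
  by split=> // g; rewrite jE mulrC -normCK chi1 expr1n scale1r.
by rewrite herg => -[c _ <-]; exists c.
Qed.

End EigenOperators.

Lemma powers_norm (R : realType) (G : time) (l : R[i])
    (chi : time_type R G -> R[i]) :
  `|l| = 1 -> powers l chi -> forall g, `|chi g| = 1.
Proof.
move=> l1; case: G chi => /= chi.
  by move=> h n; rewrite h normrX l1 expr1n.
case=> th [_ h] t; rewrite h /cis normc_def /=.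
by rewrite cos2Dsin2 sqrtr1.
Qed.

(** * The algebra of one eigenvector *)

(** Both [y y x x = y (c - x y) x] and [x x y y = x (c - y x) y] reduce, by
    centrality of [c], to the same polynomial in [y x]. For [y = x^*] this says
    that [x^2] is normal. *)
Lemma jordan_central_square (A : pzRingType) (x y c : A) :
  x * c = c * x -> y * c = c * y -> jordan y x = c ->
  y * y * (x * x) = c * (y * x) - y * x * (y * x) /\
  x * x * (y * y) = c * (y * x) - y * x * (y * x).
Proof.
move=> xc yc yx.
have yxE : y * x = c - x * y by rewrite -yx /jordan addrK.
have xyE : x * y = c - y * x by rewrite -yx /jordan addrC addKr.
have yyxx : y * y * (x * x) = c * (y * x) - y * x * (y * x).
  have -> : y * y * (x * x) = y * (y * x) * x by rewrite !mulrA.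
  rewrite {1}yxE mulrBr yc; ncring.
have xxyy : x * x * (y * y) = c * (x * y) - x * y * (x * y).
  have -> : x * x * (y * y) = x * (x * y) * y by rewrite !mulrA.
  rewrite {1}xyE mulrBr xc; ncring.
have cyx : y * x * c = c * (y * x) by rewrite -mulrA xc mulrA yc mulrA.
rewrite yyxx xxyy xyE; split=> //.
rewrite !mulrBl !mulrBr cyx; ncring.
Qed.

Section Decomposition.
Context {R : realType} {H : hilbertType R}.
Implicit Types (x y e : bounded_op H) (c s t : R[i]).

Lemma normalize_partial y y' p q s : is_adjoint y y' -> 0 < s ->
  y' * y = s *: p -> y * y' = s *: q ->
  let v := (sqrtC s)^-1 *: y in
  [/\ y = sqrtC s *: v, adjoint v * v = p & v * adjoint v = q].
Proof.
move=> yy s0 y'y yy' v.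
have r0 : 0 < sqrtC s by rewrite sqrtC_gt0.
have vr : (sqrtC s)^-1 \is Num.real by rewrite gtr0_real // invr_gt0.
have vE : adjoint v = (sqrtC s)^-1 *: y'.
  by apply: adjointE; exact: is_adjointZ_real.
have rs : (sqrtC s)^-1 * (sqrtC s)^-1 * s = 1.
  by rewrite -{3}(sqrtCK s) expr2 mulrACA !mulVf ?gt_eqF // mulr1.
split; first by rewrite scalerA divff ?gt_eqF // scale1r.
  by rewrite vE -bop_scalerAl -bop_scalerAr y'y !scalerA rs scale1r.
by rewrite vE -bop_scalerAl -bop_scalerAr yy' !scalerA rs scale1r.
Qed.

Local Notation I := (1 : bounded_op H).
(* [E] is a linear space of operators, in the application the eigenspace. *)
Variables (M E : set (bounded_op H)) (x : bounded_op H) (c d : R[i]).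
Hypotheses (hM : von_neumann_algebra M) (Mx : M x) (x0 : x <> 0).
Hypothesis E_linear : forall (k : R[i]) y z, E y -> E z -> E (k *: y + z).
Hypotheses (Ex : E x) (Exxx : E (x * (adjoint x * x))).
Hypothesis xc : jordan (adjoint x) x = c *: I.
Hypothesis xd : jordan (adjoint x * adjoint x) (x * x) = d *: I.

Let a := adjoint x * x.

Let Zl k y z : (k *: y : bounded_op H) * z = k *: (y * z).
Proof. by rewrite bop_scalerAl. Qed.
Let Zr k y z : y * (k *: z : bounded_op H) = k *: (y * z).
Proof. by rewrite bop_scalerAr. Qed.

(** The numbers [s] and [t] are the roots of the quadratic equation satisfied by
    [a]. Every scalar that occurs is real and nonnegative because the
    corresponding multiple of the identity is a sum of operators [y^* y]: for
    [c] it is [{x^*, x}], for [s t] it is [(x^2)^* x^2], and for the quarter of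
    the discriminant it is [(a - c / 2)^2]. *)
Lemma square_sum_scalars : exists s t, [/\ 0 < s, 0 <= t, t <= s, c = s + t
  & a * a = c *: a - (s * t) *: I].
Proof.
have xx := vna_is_adjoint hM Mx; have xx' := is_adjoint_sym xx.
have I0 : I <> 0 by move=> I0; apply: x0; rewrite -(mulr1 x) I0 mulr0.
have a0 : positive_op a := positive_op_sqr xx.
have b0 := positive_op_sqr xx'.
have c0 : 0 < c.
  have c0 : 0 <= c.
    by apply: positive_scalar I0 _; rewrite -xc; exact: positive_opD.
  rewrite lt_neqAle c0 andbT eq_sym; apply/eqP => c00; apply: x0.
  apply: (sqr_op_eq0 xx).
  apply: bop_quad_eq0 => u; apply/eqP; rewrite eq_le a0 andbT -oppr_ge0.
  have <- : inner ((x * adjoint x) u) u = - inner ((adjoint x * x) u) u.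
    apply/eqP; rewrite -addr_eq0 -innerDl -bopDE addrC.
    by move: xc; rewrite /jordan => ->; rewrite c00 scale0r linear0l.
  exact: b0.
have cI y : y * (c *: I) = c *: I * y by rewrite Zl Zr mulr1 mul1r.
have [yyxx xxyy] := jordan_central_square (cI x) (cI (adjoint x)) xc.
rewrite Zl mul1r -/a in yyxx xxyy.
have dI : c *: a - a * a = (d / 2) *: I.
  rewrite mulrC -scalerA -xd /jordan yyxx xxyy -mulr2n.
  rewrite -(scaler_nat 2 (c *: a - a * a)).
  by rewrite scalerA mulVf ?scale1r // pnatr_eq0.
have aaE : a * a = c *: a - (d / 2) *: I by rewrite -dI opprB addrC subrK.
have d0 : 0 <= d / 2.
  apply: positive_scalar I0 _; rewrite -dI -yyxx.
  exact: positive_op_sqr (is_adjointM xx xx).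
have c20 : 0 < c / 2 by rewrite divr_gt0.
have c2r : c / 2 \is Num.real by exact: gtr0_real.
pose delta2 := (c / 2) ^+ 2 - d / 2.
have delta20 : 0 <= delta2.
  apply: positive_scalar I0 _.
  have -> : delta2 *: I = (a - (c / 2) *: I) * (a - (c / 2) *: I).
    rewrite mulrBl !mulrBr !Zl !Zr !mulr1 !mul1r aaE /delta2 !scalerA.
    have -> : c *: a = (c / 2) *: a + (c / 2) *: a.
      by rewrite -scalerDl -splitr.
    rewrite -expr2 scalerBl; move: ((c / 2) *: a) (_ *: I) (_ *: I) => p q r.
    ncring.
  apply: positive_op_sqr; apply: is_adjointD; first exact: positive_selfadjoint.
  by apply: is_adjointN; exact: is_adjointZ_real.
pose delta := sqrtC delta2.
have delta0 : 0 <= delta by rewrite sqrtC_ge0.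
have st : (c / 2 + delta) * (c / 2 - delta) = d / 2.
  by rewrite mulrC -subr_sqr sqrtCK /delta2 subKr.
have s0 : 0 < c / 2 + delta by rewrite ltr_pwDl.
exists (c / 2 + delta), (c / 2 - delta); split=> //.
- by rewrite -(pmulr_rge0 _ s0) st.
- by rewrite lerD2l (le_trans _ delta0) // oppr_le0.
- by rewrite addrACA subrr addr0; field.
- by rewrite st.
Qed.

(** If [s <> t], the projection is [e = (a - t) / (s - t)], and
    [x a + a x = c x] becomes [x e = (1 - e) x]. Hence [x e] and [x (1 - e)]
    have initial and final projections among [e] and [1 - e], with squared
    norms [s] and [t]. Were [e] equal to [0] or [1], the exchange relation would
    give [x = 0]. *)
Lemma decomposition :
  (exists (alpha : R[i]) (v e : bounded_op H),
     [/\ x = alpha *: v,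
         E v /\ partial_isometry v,
         M e /\ projection e,
         e <> 0 /\ e <> 1
       & adjoint v * v = e /\ v * adjoint v = 1 - e])
  \/
  (exists (alpha1 alpha2 : R[i]) (v1 v2 e : bounded_op H),
     [/\ x = alpha1 *: v1 + alpha2 *: v2,
         [/\ alpha1 <> 0, alpha2 <> 0 & alpha1 <> alpha2],
         (E v1 /\ partial_isometry v1) /\ (E v2 /\ partial_isometry v2),
         [/\ M e, projection e, e <> 0 & e <> 1]
       & [/\ adjoint v1 * v1 = e, v1 * adjoint v1 = 1 - e,
             adjoint v2 * v2 = 1 - e & v2 * adjoint v2 = e]])
  \/
  (exists (alpha : R[i]) (u : bounded_op H),
     [/\ x = alpha *: u, E u & unitary u]).
Proof.
have xx := vna_is_adjoint hM Mx; have xx' := is_adjoint_sym xx.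
have aa : is_adjoint a a := is_adjointM xx' xx.
have E0 : E 0 by have := E_linear (-1) Ex Ex; rewrite scaleN1r addNr.
have EZ k y : E y -> E (k *: y).
  by move=> Ey; rewrite -[k *: y]addr0; exact: E_linear.
have [s [t [s0 t0 ts cst aaE]]] := square_sum_scalars.
have bE : x * adjoint x = c *: I - a.
  by rewrite -xc /jordan [X in X - _]addrC addrK.
have xaE : x * a = c *: x - a * x by rewrite mulrA bE mulrBl Zl mul1r.
have [tE|tNs] := eqVneq t s.
  have aE : a = s *: I.
    apply/eqP; rewrite -subr_eq0; apply/eqP.
    have as_adj : is_adjoint (a - s *: I) (a - s *: I).
      apply: is_adjointD => //; apply: is_adjointN.
      by apply: is_adjointZ_real => //; exact: gtr0_real.
    apply: (sqr_op_eq0 as_adj).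
    rewrite mulrBl !mulrBr !Zl !Zr !mulr1 !mul1r aaE cst tE scalerDl scalerA.
    move: (s *: a) (_ *: I) => p q; ncring.
  right; right; exists (sqrtC s), ((sqrtC s)^-1 *: x).
  have [|xE vv vv'] := normalize_partial (p := I) (q := I) xx s0 aE.
    by rewrite bE aE cst tE scalerDl addrK.
  by split=> //; exact: EZ.
have r0 : 0 < (s - t)^-1 by rewrite invr_gt0 subr_gt0 lt_neqAle tNs.
set r := (s - t)^-1 in r0.
have rst : r * (s - t) = 1 by rewrite mulVf // subr_eq0 eq_sym.
have rr : r \is Num.real by exact: gtr0_real.
have tr : t \is Num.real by exact: ger0_real.
pose e := r *: (a - t *: I).
have fE : 1 - e = r *: (s *: I - a).
  rewrite /e -[X in X - _]scale1r -rst -scalerA -scalerBr scalerBl.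
  by congr (_ *: _); move: (s *: I) (t *: I) => p q; ncring.
have aeE : a * e = s *: e.
  rewrite /e Zr scalerA [s * r]mulrC -scalerA; congr (_ *: _).
  rewrite mulrBr Zr mulr1 aaE cst scalerDl scalerBr scalerA.
  move: (s *: a) (t *: a) (_ *: I) => p q u; ncring.
have ea : e * a = a * e by rewrite /e Zr Zl mulrBl mulrBr Zl Zr mul1r mulr1.
have eaE : e * a = s *: e by rewrite ea.
have faE : (1 - e) * a = t *: (1 - e).
  rewrite fE Zl scalerA [t * r]mulrC -scalerA; congr (_ *: _).
  rewrite mulrBl Zl mul1r aaE cst scalerDl scalerBr scalerA [t * s]mulrC.
  move: (s *: a) (t *: a) (_ *: I) => p q u; ncring.
have ee : e * e = e.
  rewrite {1}/e Zl mulrBl aeE Zl mul1r -scalerBl scalerA rst scale1r //.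
have fe : (1 - e) * e = 0 by rewrite mulrBl mul1r ee subrr.
have ff : (1 - e) * (1 - e) = 1 - e by rewrite mulrBr mulr1 fe subr0.
have ead : is_adjoint e e.
  apply: is_adjointZ_real => //; apply: is_adjointD => //.
  by apply: is_adjointN; exact: is_adjointZ_real.
have fad : is_adjoint (1 - e) (1 - e).
  by apply: is_adjointD => //; exact: is_adjointN.
have pe : projection e by split=> //; exact: adjointE.
have pf : projection (1 - e) by split=> //; exact: adjointE.
have Ma : M a by apply: vnaM => //; exact: vna_adjoint_mem.
have Me : M e by apply/(vnaZ hM)/(vnaB hM)/(vnaZ hM)/(vna1 hM).
have xe : x * e = (1 - e) * x.
  rewrite fE /e Zr Zl mulrBr mulrBl Zr Zl mulr1 mul1r xaE cst scalerDl.
  congr (_ *: _); move: (s *: x) (t *: x) (a * x) => p q u.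
  ncring.
have xf : x * (1 - e) = e * x by rewrite mulrBr mulr1 xe mulrBl mul1r subKr.
have e0 : e <> 0.
  move=> e0; apply: x0.
  by rewrite -(mul1r x) -[X in X * _]subr0 -e0 -xe e0 mulr0.
have e1 : e <> 1.
  by move=> e1; apply: x0; rewrite -(mulr1 x) -e1 xe e1 subrr mul0r.
have Ey1 : E (x * e).
  rewrite /e Zr mulrBr Zr mulr1; apply: EZ.
  rewrite addrC -scaleNr; exact: E_linear.
have Ey2 : E (x * (1 - e)).
  by rewrite mulrBr mulr1 addrC -scaleN1r; exact: E_linear.
have y1y1 : e * adjoint x * (x * e) = s *: e.
  by rewrite mulrA -(mulrA e) -/a eaE Zl ee.
have y1y1' : x * e * (e * adjoint x) = s *: (1 - e).
  rewrite mulrA -(mulrA x) ee xe -mulrA bE mulrBr Zr mulr1 faE cst scalerDl.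
  by rewrite addrK.
have y2y2 : (1 - e) * adjoint x * (x * (1 - e)) = t *: (1 - e).
  by rewrite mulrA -(mulrA (1 - e)) -/a faE Zl ff.
have y2y2' : x * (1 - e) * ((1 - e) * adjoint x) = t *: e.
  rewrite mulrA -(mulrA x) ff xf -mulrA bE mulrBr Zr mulr1 eaE cst scalerDl.
  by rewrite [s *: e + _]addrC addrK.
have adj1 : is_adjoint (x * e) (e * adjoint x) by exact: is_adjointM.
have adj2 : is_adjoint (x * (1 - e)) ((1 - e) * adjoint x) by exact: is_adjointM.
have xsum : x = x * e + x * (1 - e) by rewrite -mulrDr addrC subrK mulr1.
have [v1E v1v1 v1v1'] := normalize_partial adj1 s0 y1y1 y1y1'.
have [t00|tN0] := eqVneq t 0.
  left; exists (sqrtC s), ((sqrtC s)^-1 *: (x * e)), e; split=> //.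
  - rewrite -v1E {1}xsum (sqr_op_eq0 adj2) ?addr0 //.
    by rewrite y2y2 t00 scale0r.
  - by split; [exact: EZ|rewrite /partial_isometry v1v1].
have t1 : 0 < t by rewrite lt_neqAle eq_sym tN0.
have [v2E v2v2 v2v2'] := normalize_partial adj2 t1 y2y2 y2y2'.
right; left; exists (sqrtC s), (sqrtC t), ((sqrtC s)^-1 *: (x * e)),
  ((sqrtC t)^-1 *: (x * (1 - e))), e; split=> //.
- by rewrite -v1E -v2E.
- split; try by apply/eqP; rewrite gt_eqF // sqrtC_gt0.
  by apply/eqP; rewrite eqr_sqrtC ?nnegrE ?ltW // eq_sym.
- by split; (split; [exact: EZ|rewrite /partial_isometry ?v1v1 ?v2v2]).
Qed.

End Decomposition.

(** * The theorem *)

Unset Implicit Arguments.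

Theorem mainTheorem1 (R : realType) (H : hilbertType R)
  (M : set (bounded_op H)) (hM : von_neumann_algebra M)
  (G : time) (Phi : time_type R G -> bounded_op H -> bounded_op H)
  (hPhi : forall g, normal_positive_unital M (Phi g))
  (hsemi : semigroup M Phi)
  (omega : bounded_op H -> R[i]) (homega : normal_faithful_state M omega)
  (hinv : forall g y, M y -> omega (Phi g y) = omega y)
  (herg : ergodic M Phi)
  (lambda : R[i]) (hlambda : `|lambda| = 1)
  (lambda_pow : time_type R G -> R[i]) (hpow : powers lambda lambda_pow)
  (heig : semigroup_eigenvalue M Phi lambda_pow)
  (x : bounded_op H) (hx : semigroup_eigenspace M Phi lambda_pow x) (x_neq0 : x <> 0) :
  (exists (alpha : R[i]) (v e : bounded_op H),
     [/\ x = alpha *: v,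
         semigroup_eigenspace M Phi lambda_pow v /\ partial_isometry v,
         M e /\ projection e,
         e <> 0 /\ e <> 1
       & adjoint v * v = e /\ v * adjoint v = 1 - e])
  \/
  (exists (alpha1 alpha2 : R[i]) (v1 v2 e : bounded_op H),
     [/\ x = alpha1 *: v1 + alpha2 *: v2,
         [/\ alpha1 <> 0, alpha2 <> 0 & alpha1 <> alpha2],
         (semigroup_eigenspace M Phi lambda_pow v1 /\ partial_isometry v1) /\
         (semigroup_eigenspace M Phi lambda_pow v2 /\ partial_isometry v2),
         [/\ M e, projection e, e <> 0 & e <> 1]
       & [/\ adjoint v1 * v1 = e, v1 * adjoint v1 = 1 - e,
             adjoint v2 * v2 = 1 - e & v2 * adjoint v2 = e]])
  \/
  (exists (alpha : R[i]) (u : bounded_op H),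
     [/\ x = alpha *: u, semigroup_eigenspace M Phi lambda_pow u & unitary u]).
Proof.
have chi1 := powers_norm hlambda hpow.
have [Mx _] := hx; have xx := vna_is_adjoint hM Mx.
have xE := eigenspace_adjoint hM hPhi hx.
have x2E := eigenspace_square hM hPhi homega hinv chi1 hx.
have [c xc] := ergodic_square_sum hM hPhi homega hinv herg chi1 hx.
have chi2 g : `|lambda_pow g * lambda_pow g| = 1 by rewrite normrM chi1 mulr1.
have [d] := ergodic_square_sum hM hPhi homega hinv herg chi2 x2E.
rewrite (adjointE (is_adjointM xx xx)) => xd.
apply: (decomposition hM Mx x_neq0 _ hx _ xc xd) => [k y z|].
  exact: eigenspace_linear.
(* x x^* x = c x - {x^*, x^2} / 2, and {x^*, x^2} has the eigenvalue of x *)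
have jE : semigroup_eigenspace M Phi lambda_pow (jordan (adjoint x) (x * x)).
  have [g|Mj jE] := eigenspace_jordan hM hPhi homega hinv _ xE x2E.
    by rewrite norm_conjC.
  by split=> // g; rewrite jE mulrA (mulrC _^*) -normCK chi1 expr1n mul1r.
have xxE : x * x * adjoint x = c *: x - x * (adjoint x * x).
  have E : x * adjoint x = c *: (1 : bounded_op H) - adjoint x * x.
    by rewrite -xc /jordan [X in X - _]addrC addrK.
  by rewrite -mulrA E mulrBr -bop_scalerAr mulr1.
have axE : adjoint x * (x * x) = c *: x - x * (adjoint x * x).
  have E : adjoint x * x = c *: (1 : bounded_op H) - x * adjoint x.
    by rewrite -xc /jordan addrK.
  by rewrite mulrA {1}E mulrBl -bop_scalerAl mul1r -mulrA.
suff <- : - 2^-1 *: jordan (adjoint x) (x * x) + c *: x =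
    x * (adjoint x * x).
  by apply: (eigenspace_linear hM hPhi _ jE); exact: eigenspaceZ.
rewrite /jordan xxE axE -mulr2n -(scaler_nat 2 (c *: x - _)) scalerA mulNr.
by rewrite mulVf ?pnatr_eq0 // scaleN1r opprB subrK.
Qed.
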